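(* With a two-layer decoder, $\{a^nb^n\mid n\in\mathbb{N}\}\in D_2(\text{s-QRNN})$. That is, for $\Sigma=\{a,b\}$, there exist an s-QRNN over $\Sigma$ and a two-layer threshold decoder $\mathbf d_2$ such that for all $x\in\Sigma^*$: $\mathbf d_2(\mathbf h_{|x|})=1$ if $x\in\{a^nb^n\mid n\in\mathbb{N}\}$ and $\mathbf d_2(\mathbf h_{|x|})=0$ otherwise, where $\mathbf h_{|x|}$ is the final state of the s-QRNN on $x$.
   Context: $\mathbb{N}=\{0,1,2,\dots\}$. QRNN of window length $w$ and dimension $k$: with an embedding $\Sigma\to\mathbb{Q}^{d_x}$, $x_t\mapsto\mathbf x_t$, and $\mathbf X$ the matrix of input vectors, let $\mathbf z_t,\mathbf f_t,\mathbf i_t,\mathbf o_t\in\mathbb{Q}^k$ be the rows of $\mathbf Z=\tanh(\mathbf W^z*\mathbf X)$, $\mathbf F=\sigma(\mathbf W^f*\mathbf X)$, $\mathbf I=\sigma(\mathbf W^i*\mathbf X)$, $\mathbf O=\sigma(\mathbf W^o*\mathbf X)$, where $*$ is convolution over time with window length $w$, rational weights $\mathbf W^\bullet\in\mathbb{Q}^{d_x\times w\times k}$, and rational biases allowed (so row $t$ is the activation applied to an affine function of $\mathbf x_{t-w+1},\dots,\mathbf x_t$, zero-padded before the start). Then $\mathbf c_0=\mathbf h_0=\mathbf 0$, $\mathbf c_t=\mathbf f_t\odot\mathbf c_{t-1}+\mathbf i_t\odot\mathbf z_t$, $\mathbf h_t=\mathbf o_t\odot\mathbf c_t$. Saturation: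 the s-QRNN is the QRNN in which $\sigma$ is replaced by the step function equal to $1$ on positive and $0$ on negative arguments, and $\tanh$ by the sign function with values in $\{-1,0,1\}$; parameters are such that no argument of a $\sigma$ is exactly $0$ on any input, so all gates lie in $\{0,1\}$. Two-layer decoder: $\mathbf d_2(\mathbf h)=\mathbb{1}_{>0}(\mathbf w'\cdot\mathbb{1}_{>0}(\mathbf W\mathbf h+\mathbf b)+b')$, with $\mathbb{1}_{>0}$ applied coordinatewise and the first layer of arbitrary finite width; $D_2(E)$ is the set of languages decided by an encoder of type $E$ followed by such a decoder applied to its final state. *)

(* Defs.v *)
From mathcomp Require Import all_boot all_order all_algebra.

Set Implicit Arguments.
Unset Strict Implicit.
Unset Printing Implicit Defensive.

Import Order.TTheory GRing.Theory Num.Theory.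
Local Open Scope ring_scope.

(* The indicator of (0, +oo).  It is also the saturated sigmoid, whose value
   at 0 is immaterial: see [gates_nonzero]. *)
Definition ind_gt0 (x : rat) : rat := (0 < x)%R%:R.

Definition hadamard k (u v : 'cV[rat]_k) : 'cV[rat]_k := map2_mx *%R u v.

Section QRNN.

Variable Sigma : Type.

(* The filters of one convolution with d input channels, window length w and
   k output channels: [tap W j] is the transpose of the slice W[:, j, :]
   of the d x w x k weight tensor W. *)
Record filters (d w k : nat) := Filters {
  tap : 'I_w -> 'M[rat]_(k, d);
  bias : 'cV[rat]_k }.

Record qrnn (k : nat) := QRNN {
  window : nat;
  window_gt0 : (0 < window)%N;
  dim_in : nat;
  embed : Sigma -> 'cV[rat]_dim_in;
  Wz : filters dim_in window k;
  Wf : filters dim_in window k;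
  Wi : filters dim_in window k;
  Wo : filters dim_in window k }.

Section Run.

Variables (k : nat) (q : qrnn k) (x : seq Sigma).

(* Times are 0-based in [padded_input], [conv] and the gates below: time t
   concerns the (t+1)-st letter of x.  Since w - 1 zero vectors are prepended,
   entry t + j of [padded_input] is the input vector at time t - (w - 1) + j,
   so that j = w - 1 is the current letter. *)
Definition padded_input : seq 'cV[rat]_(dim_in q) :=
  nseq (window q).-1 0 ++ map (embed q) x.

Definition conv (W : filters (dim_in q) (window q) k) (t : nat) : 'cV[rat]_k :=
  bias W + \sum_(j < window q) tap W j *m nth 0 padded_input (t + j).

Variables sigma tanh : rat -> rat.

Definition gate_z t := map_mx tanh (conv (Wz q) t).
Definition gate_f t := map_mx sigma (conv (Wf q) t).
Definition gate_i t := map_mx sigma (conv (Wi q) t).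
Definition gate_o t := map_mx sigma (conv (Wo q) t).

(* The states after t letters have been read. *)
Fixpoint cell (t : nat) : 'cV[rat]_k :=
  if t is s.+1 then
    hadamard (gate_f s) (cell s) + hadamard (gate_i s) (gate_z s)
  else 0.

Definition hidden (t : nat) : 'cV[rat]_k :=
  if t is s.+1 then hadamard (gate_o s) (cell t) else 0.

End Run.

Definition gates_nonzero k (q : qrnn k) : Prop :=
  forall (x : seq Sigma) (t : nat) (l : 'I_k), (t < size x)%N ->
    [/\ conv x (Wf q) t l 0 != 0,
        conv x (Wi q) t l 0 != 0
      & conv x (Wo q) t l 0 != 0].

Definition s_qrnn_final k (q : qrnn k) (x : seq Sigma) : 'cV[rat]_k :=
  hidden q x ind_gt0 Num.sg (size x).

(* A type of encoders is a family of sets of maps from words to vectors. *)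
Definition encoder_type := forall k : nat, (seq Sigma -> 'cV[rat]_k) -> Prop.

Definition s_QRNN : encoder_type := fun k enc =>
  exists2 q : qrnn k, gates_nonzero q & enc =1 s_qrnn_final q.

Record decoder2 (k : nat) := Decoder2 {
  width : nat;
  dec_W : 'M[rat]_(width, k);
  dec_b : 'cV[rat]_width;
  dec_w' : 'rV[rat]_width;
  dec_b' : rat }.

Definition decode2 k (d : decoder2 k) (h : 'cV[rat]_k) : rat :=
  ind_gt0 ((dec_w' d *m map_mx ind_gt0 (dec_W d *m h + dec_b d)) 0 0
           + dec_b' d).

Definition D2 (E : encoder_type) (L : seq Sigma -> Prop) : Prop :=
  exists (k : nat) (enc : seq Sigma -> 'cV[rat]_k) (d : decoder2 k),
    E k enc /\
    forall x : seq Sigma, (L x -> decode2 d (enc x) = 1) /\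
                          (~ L x -> decode2 d (enc x) = 0).

End QRNN.

Arguments s_QRNN : clear implicits.

Inductive ab : Type := a | b.

Definition anbn (x : seq ab) : Prop :=
  exists n : nat, x = nseq n a ++ nseq n b.

(* Main.v *)
Require Import Defs.
From mathcomp Require Import all_boot all_order all_algebra.
From mathcomp Require Import lra.

(** A word is some a^n b^n iff it has as many a's as b's and no factor ba.  With
    all forget gates open the cell adds up its increments, so one coordinate can
    hold #a - #b, incremented by the sign of the current letter, and another the
    number of factors ba, its input gate opening on each of them (window length
    2).  Both are integers, and three first-layer threshold units test whether
    one of them is nonzero. *)

Import Order.TTheory GRing.Theory Num.Theory.
Local Open Scope ring_scope.

Definition letter_sign (c : ab) : rat := if c is a then 1 else -1.

(* The padding vector has value 0, so [descent p c] singles out the factor ba: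
   only there is the difference of consecutive values 2, the others being at
   most 1. *)
Definition descent (p c : rat) : bool := 3 / 2 < c - p.

Notation descent_free := (path (fun p c => ~~ descent p c)).

Definition signs (x : seq ab) : seq rat := map letter_sign x.

Lemma signs_nseq n c : signs (nseq n c) = nseq n (letter_sign c).
Proof. exact: map_nseq. Qed.

(** A step from [p] up to 1 is at most 1, hence below 3/2. The bound [0 <= p] covers a predecessor
    that is padding or an a. *)
Lemma descent_free_cons_a p x : 0 <= p ->
  descent_free p (signs (a :: x))
  = descent_free 1 (signs x).
Proof.
move=> p_ge0; rewrite /= /descent.
by have -> : 3 / 2 < 1 - p = false by apply/negbTE; lra.
Qed.

Lemma descent_free_cons_b p x : -1 <= p ->
  descent_free p (signs (b :: x))
  = descent_free (-1) (signs x).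
Proof.
move=> p_ge; rewrite /= /descent.
by have -> : 3 / 2 < -1 - p = false by apply/negbTE; lra.
Qed.

Lemma descent_free_b x : descent_free (-1) (signs x) ->
  x = nseq (size x) b.
Proof. by elim: x => [//|[] //= x IHx /IHx <-]. Qed.

Lemma descent_free_nseq_b n p : -1 <= p ->
  descent_free p (signs (nseq n b)).
Proof.
elim: n p => [//|n IHn] p p_ge; rewrite [nseq _ _]/= descent_free_cons_b //.
exact: IHn.
Qed.

(** The induction ranges over all [p >= 0] because the predecessor passes from padding (0) to a (1).
    Once a b has been read, the next a would create a descent, so only b's can follow. *)
Lemma descent_freeP x p : 0 <= p ->
  descent_free p (signs x) <->
  exists m n, x = nseq m a ++ nseq n b.
Proof.
move=> p_ge0; split.
  elim: x p p_ge0 => [|[] x IHx] p p_ge0; first by exists 0%N, 0%N.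
    rewrite descent_free_cons_a // => /(IHx _ ler01) [m [n ->]].
    by exists m.+1, n.
  have p_ge : -1 <= p by lra.
  rewrite descent_free_cons_b // => /descent_free_b ->.
  by exists 0%N, (size x).+1.
move=> [m [n ->]] {x}; elim: m p p_ge0 => [|m IHm] p p_ge0.
  by apply: descent_free_nseq_b; lra.
by rewrite cat_cons descent_free_cons_a // IHm.
Qed.

Lemma sum_signs_anbm m n :
  \sum_(c <- signs (nseq m a ++ nseq n b)) c = m%:R - n%:R.
Proof.
rewrite /signs map_cat -!/(signs _) !signs_nseq big_cat !big_nseq /=.
by rewrite !iter_addr_0 mulNrn.
Qed.

Lemma anbnP x :
  anbn x <-> \sum_(c <- signs x) c = 0 /\
             descent_free 0 (signs x).
Proof.
split=> [[n ->]|[+ /(descent_freeP x 0 (lexx 0)) [m [n x_def]]]].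
  split; first by rewrite sum_signs_anbm subrr.
  by apply/descent_freeP => //; exists n, n.
rewrite x_def sum_signs_anbm => /eqP; rewrite subr_eq0 eqr_nat => /eqP <-.
by exists m.
Qed.

Lemma cellS Sigma k (q : qrnn Sigma k) x sigma tanh t l :
  cell q x sigma tanh t.+1 l 0
  = sigma (conv x (Wf q) t l 0) * cell q x sigma tanh t l 0
    + sigma (conv x (Wi q) t l 0) * tanh (conv x (Wz q) t l 0).
Proof. by rewrite /= !mxE. Qed.

Lemma hiddenS Sigma k (q : qrnn Sigma k) x sigma tanh t l :
  hidden q x sigma tanh t.+1 l 0
  = sigma (conv x (Wo q) t l 0) * cell q x sigma tanh t.+1 l 0.
Proof. by rewrite /hidden /hadamard mxE mxE. Qed.

(** [u] weights the previous letter, [v] the current one, and [w] is the bias. *)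
Definition filter2 (u v w : 'I_2 -> rat) : filters 1 2 2 :=
  {| tap j := \matrix_(l, _) (if j == 0 then u l else v l);
     bias := \col_l w l |}.

Definition open_filter := filter2 (fun=> 0) (fun=> 0) (fun=> 1).

(** The filters come in the order z, f, i, o. Coordinate 0 always admits the sign of the current
    letter; coordinate 1 offers the constant 1 and admits it when current minus previous exceeds
    3/2. *)
Definition counter : qrnn ab 2 :=
  @QRNN ab 2 2 isT 1 (fun c => (letter_sign c)%:M)
    (filter2 (fun=> 0) (fun l => (l == 0)%:R) (fun l => (l != 0)%:R))
    open_filter
    (filter2 (fun l => - (l != 0)%:R) (fun l => (l != 0)%:R)
             (fun l => if l == 0 then 1 else - (3 / 2)))
    open_filter.

(** Window length 2 prepends a single zero vector, whence the leading 0. *)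
Lemma padded_counterE x t :
  nth 0 (padded_input counter x) t = (nth 0 (0 :: signs x) t)%:M.
Proof.
have -> : padded_input counter x
          = [seq (c%:M : 'cV[rat]_1) | c <- 0 :: signs x].
  by rewrite /padded_input /signs /= -map_comp raddf0.
have [lt_t|le_t] := ltnP t (size (0 :: signs x)).
  by rewrite (nth_map 0).
by rewrite !nth_default ?size_map // raddf0.
Qed.

Lemma conv_counterE x u v w t l :
  @conv _ _ counter x (filter2 u v w) t l 0
  = w l + (u l * nth 0 (0 :: signs x) t + v l * nth 0 (signs x) t).
Proof.
rewrite /conv mxE summxE !big_ord_recl big_ord0 /= addr0 !padded_counterE.
by rewrite !mul_mx_scalar !mxE /= addn0 addn1 [_ * u l]mulrC [_ * v l]mulrC.
Qed.

Lemma conv_openE x t l : @conv _ _ counter x open_filter t l 0 = 1.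
Proof. by rewrite conv_counterE !mul0r !addr0. Qed.

(** The value 0 arises only as the default past the end of the word. *)
Lemma nth_signs x t : [\/ nth 0 (signs x) t = 0, nth 0 (signs x) t = 1
                        | nth 0 (signs x) t = -1].
Proof.
elim: x t => [|c x IHx] [|t] /=; rewrite ?nth_nil; try by constructor 1.
  by case: c; [constructor 2 | constructor 3].
exact: IHx.
Qed.

Lemma nth_padded_signs x t :
  [\/ nth 0 (0 :: signs x) t = 0, nth 0 (0 :: signs x) t = 1
    | nth 0 (0 :: signs x) t = -1].
Proof. by case: t => [|t]; [constructor 1 | exact: nth_signs]. Qed.

Lemma counter_gates_nonzero : gates_nonzero counter.
Proof.
move=> x t l _; split; rewrite ?conv_openE ?oner_eq0 // conv_counterE.
case: (l == 0); first by rewrite oppr0 !mul0r !addr0 oner_eq0.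
(* The argument is an integer minus 3/2, so never 0; a threshold of 1 would give 0 on an initial
   a. *)
by case: (nth_padded_signs x t) => ->; case: (nth_signs x t) => ->.
Qed.

Definition increment x s (l : 'I_2) : rat :=
  if l == 0 then nth 0 (signs x) s
  else (descent (nth 0 (0 :: signs x) s) (nth 0 (signs x) s))%:R.

Lemma cell_counterE x t l :
  cell counter x ind_gt0 Num.sg t l 0 = \sum_(s < t) increment x s l.
Proof.
elim: t => [|t IHt]; first by rewrite big_ord0 mxE.
rewrite big_ord_recr /= -IHt cellS conv_openE {1}/ind_gt0 ltr01 mul1r.
congr (_ + _); rewrite !conv_counterE /increment /ind_gt0.
case: (l == 0).
  rewrite oppr0 !mul0r !addr0 ltr01 !mul1r !add0r.
  (* The saturated tanh fixes -1, 0 and 1, so the letter sign passes unchanged. *)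
  by case: (nth_signs x t) => ->; rewrite ?sgr0 ?sgr1 ?sgrN1.
rewrite /descent !mul0r !addr0 sgr1 mulr1 mul1r mulN1r.
by congr ((_ : bool)%:R); apply/idP/idP; lra.
Qed.

Lemma counter_finalE x l :
  s_qrnn_final counter x l 0 = \sum_(s < size x) increment x s l.
Proof.
rewrite -cell_counterE /s_qrnn_final; case: (size x) => [//|t].
by rewrite hiddenS conv_openE /ind_gt0 ltr01 mul1r.
Qed.

Lemma counter_final_balance x :
  s_qrnn_final counter x 0 0 = \sum_(c <- signs x) c.
Proof. by rewrite counter_finalE (big_nth 0) big_mkord size_map. Qed.

Lemma counter_final_descents_ge0 x : 0 <= s_qrnn_final counter x 1 0.
Proof. by rewrite counter_finalE sumr_ge0 // => s _; rewrite ler0n. Qed.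

(** A sum of nonnegative terms vanishes iff every term does, and [pathP] indexes neighbouring
    letters exactly as [increment] does. *)
Lemma counter_final_descents_eq0 x :
  s_qrnn_final counter x 1 0 = 0 <->
  descent_free 0 (signs x).
Proof.
rewrite counter_finalE; split=> [/eqP|/(pathP 0) free].
  rewrite psumr_eq0 => [/allP free|s _]; last exact: ler0n.
  apply/(pathP 0) => s; rewrite size_map => lt_s.
  have := free (Ordinal lt_s) (mem_index_enum _).
  by rewrite /increment /= pnatr_eq0 eqb0.
rewrite big1 // => s _; rewrite /increment /=.
by rewrite (negbTE (free s _)) // size_map.
Qed.

(** The units fire on a positive balance, a negative balance and a positive descent count. The
    output argument is 1 minus the number of firing units, which is positive iff none fires. *)
Definition zero_test : decoder2 2 :=
  {| dec_W := \matrix_(i < 3, l < 2)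
       (if i == 0 then (l == 0)%:R
        else if i == 1 then - (l == 0)%:R else (l == 1)%:R);
     dec_b := 0;
     dec_w' := const_mx (-1);
     dec_b' := 1 |}.

Lemma zero_testE (h : 'cV[rat]_2) : 0 <= h 1 0 ->
  decode2 zero_test h = ((h 0 0 == 0) && (h 1 0 == 0))%:R.
Proof.
move=> h1_ge0; rewrite /decode2 mxE !big_ord_recl big_ord0 /= !mxE.
rewrite !big_ord_recl !big_ord0 /= !(mxE, eqxx) /=.
rewrite (_ : lift 0 0 = 1); last exact: val_inj.
rewrite !(mul0r, mul1r, mulN1r, add0r, addr0, oppr0) /ind_gt0.
(* For the nonnegative [h 1 0], being positive amounts to being nonzero, so one unit tests it. *)
rewrite oppr_gt0 (lt_def 0 (h 1 0)) h1_ge0 andbT.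
by case: (h 1 0 == 0); case: (ltgtP 0 (h 0 0)).
Qed.

Theorem theorem10 : D2 (s_QRNN ab) anbn.
Proof.
exists 2%N, (s_qrnn_final counter), zero_test; split.
  by exists counter; first exact: counter_gates_nonzero.
move=> x; rewrite zero_testE ?counter_final_descents_ge0 //.
have accept : (s_qrnn_final counter x 0 0 == 0) &&
    (s_qrnn_final counter x 1 0 == 0) <-> anbn x.
  rewrite anbnP -counter_final_descents_eq0 -counter_final_balance.
  by split=> [/andP[/eqP ? /eqP ?]|[-> ->]].
split=> [/accept -> //|notL].
by rewrite (introF idP (fun h => notL (proj1 accept h))).
Qed.
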